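(* Let $Y$ be a topological vector space, let $A$ be a closed proper subset of $Y$, and let $k\in-0^+A\setminus\{0\}$. Then $0^+A$ is a closed proper subset of $Y$ and $k\in-0^+(0^+A)\setminus\{0\}$. For $y^0\in A+\mathbb{R}k$ and $y^1\in0^+A+\mathbb{R}k$, we have $y^0+y^1\in A+\mathbb{R}k$ and $$\varphi_{A,k}(y^0+y^1)\le\varphi_{A,k}(y^0)+\varphi_{0^+A,k}(y^1).$$
   Context: Vector spaces are real. ''Proper subset of $Y$'' means nonempty and different from $Y$. $0^+A=\{u\in Y\mid a+tu\in A\ \forall a\in A,\ \forall t\ge0\}$ is the recession cone. $\nu$ is a symbolic value not in $\overline{\mathbb{R}}=\mathbb{R}\cup\{\pm\infty\}$, and $\inf\emptyset:=\nu$. For $M\subseteq Y$, $\varphi_{M,k}:Y\to\overline{\mathbb{R}}\cup\{\nu\}$ is $\varphi_{M,k}(y)=\inf\{t\in\mathbb{R}\mid y\in tk+M\}$. It never takes the value $+\infty$, and for $y\in M+\mathbb{R}k$ the value lies in $\mathbb{R}\cup\{-\infty\}$; sums involving $-\infty$ are $-\infty$. *)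

(* Defs.v *)
From HB Require Import structures.
From mathcomp Require Import all_boot all_order all_algebra.
From mathcomp Require Import all_classical all_reals all_analysis.

Set Implicit Arguments.
Unset Strict Implicit.
Unset Printing Implicit Defensive.

Import Order.TTheory GRing.Theory Num.Theory.
Import numFieldNormedType.Exports.

Local Open Scope classical_set_scope.
Local Open Scope ring_scope.

Definition proper_subset (T : Type) (A : set T) : Prop :=
  A !=set0 /\ A <> setT.

Definition minkowski_sum (V : zmodType) (A B : set V) : set V :=
  [set a + b | a in A & b in B].

Definition opp_set (V : zmodType) (A : set V) : set V := [set - a | a in A].

Definition line (R : realType) (V : lmodType R) (k : V) : set V :=
  [set t *: k | t in [set: R]].

Definition recession_cone (R : realType) (V : lmodType R) (A : set V) : set V :=
  [set u | forall a, A a -> forall t : R, 0 <= t -> A (a + t *: u)].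

(* The extended reals with an extra symbol nu; nu is encoded by None. *)
Definition ereal_nu (R : realType) : Type := option (\bar R).

(* The infimum in the extended reals of a set of reals, except that the infimum
   of the empty set is nu and not +oo. *)
Definition inf_nu (R : realType) (S : set R) : ereal_nu R :=
  if `[< S !=set0 >] then Some (ereal_inf (EFin @` S)) else None.

(* The library's addition on \bar R already satisfies -oo + x = x + -oo = -oo
   for every x, including x = +oo. *)
Definition add_nu (R : realType) (x y : ereal_nu R) : ereal_nu R :=
  match x, y with
  | Some a, Some b => Some (a + b)%E
  | _, _ => None
  end.

(* nu is comparable to nothing: an inequality holds only if both sides are
   extended real numbers. *)
Definition le_nu (R : realType) (x y : ereal_nu R) : Prop :=
  match x, y with
  | Some a, Some b => (a <= b)%E
  | _, _ => False
  end.

Definition phi (R : realType) (V : lmodType R) (M : set V) (k y : V) :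
    ereal_nu R :=
  inf_nu [set t : R | [set t *: k + m | m in M] y].

(* Main.v *)
Require Import Defs.
From HB Require Import structures.
From mathcomp Require Import all_boot all_order all_algebra.
From mathcomp Require Import all_classical all_reals all_analysis.

Set Implicit Arguments.
Unset Strict Implicit.
Unset Printing Implicit Defensive.

Import Order.TTheory GRing.Theory Num.Theory.
Import numFieldNormedType.Exports.

Local Open Scope classical_set_scope.
Local Open Scope ring_scope.

(** Adding a vector of the recession cone never leaves [A], that is, [A + 0^+A]
    is contained in [A].  If [y0 = t0 k + a] and [y1 = t1 k + u] with [a] in
    [A] and [u] in [0^+A], then [y0 + y1 = (t0 + t1) k + (a + u)] with [a + u]
    in [A]; so the sum of a real admissible for [phi A k y0] and one admissible
    for [phi (0^+A) k y1] is admissible for [phi A k (y0 + y1)], and passing to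
    infima gives the inequality ([le_inf_nuD]).

    Moving along two recession directions in turn shows that [0^+A] is contained
    in its own recession cone, which therefore also contains [-k].  The cone
    contains [0]; it is not the whole space, since otherwise [A] would be stable
    under every translation and hence be everything.  It is closed as an
    intersection of preimages of [A] under the continuous maps
    [u |-> a + t u]. *)

Lemma recession_cone_add (R : realType) (V : lmodType R) (A : set V) (a u : V) :
  A a -> recession_cone A u -> A (a + u).
Proof. by move=> Aa /(_ a Aa 1 ler01); rewrite scale1r. Qed.

Lemma recession_cone0 (R : realType) (V : lmodType R) (A : set V) :
  recession_cone A 0.
Proof. by move=> a Aa t _; rewrite scaler0 addr0. Qed.

(** The point [a + s (u + t v)] is reached from [a] by moving first along [u]
    and then along [v], without leaving [A]. *)
Lemma recession_cone_sub_idem (R : realType) (V : lmodType R) (A : set V) :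
  recession_cone A `<=` recession_cone (recession_cone A).
Proof.
move=> v rv u ru t t0 a Aa s s0.
rewrite scalerDr scalerA addrA.
by apply: rv; [apply: ru | apply: mulr_ge0].
Qed.

(** If every vector were a recession direction, a single point of [A] could be
    translated onto any other point. *)
Lemma recession_cone_proper (R : realType) (V : lmodType R) (A : set V) :
  proper_subset A -> proper_subset (recession_cone A).
Proof.
case=> -[a Aa] AnT; split; first by exists 0; exact: recession_cone0.
move=> rT; apply: AnT; apply/seteqP; split=> // y _.
have : recession_cone A (y - a) by rewrite rT.
by move=> /(recession_cone_add Aa); rewrite addrC subrK.
Qed.

Lemma closed_recession_cone (R : realType) (Y : topologicalLmodType R)
    (A : set Y) :
  closed A -> closed (recession_cone A).
Proof.
move=> Acl.
have -> : recession_cone A =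
    \bigcap_(p in [set p : Y * R | A p.1 /\ 0 <= p.2])
      ((fun u => p.1 + p.2 *: u) @^-1` A).
  apply/seteqP; split=> u ru.
    by move=> [a t] /= [Aa t0]; exact: ru.
  by move=> a Aa t t0; apply: (ru (a, t)).
apply: closed_bigI => -[a t] _ /=.
apply: preimage_closed Acl => u _.
have cvg_scale : t *: v @[v --> u] --> t *: u.
  apply: (continuous2_cvg _ (scale_continuous (t, u))) => //.
  exact: cvg_cst.
apply: (continuous2_cvg _ (add_continuous (a, t *: u))) => //.
exact: cvg_cst.
Qed.

(** Nonemptiness of [S] and [T] excludes both the symbol nu and the value +oo
    on the right.  The value -oo remains possible there, and is the case where
    one cannot subtract the infimum of [S]. *)
Lemma le_inf_nuD (R : realType) (S T U : set R) :
  S !=set0 -> T !=set0 -> (forall s t, S s -> T t -> U (s + t)) ->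
  le_nu (inf_nu U) (add_nu (inf_nu S) (inf_nu T)).
Proof.
move=> [s Ss] [t Tt] STU.
have U0 : U !=set0 by exists (s + t); exact: STU.
have S0 : S !=set0 by exists s.
have T0 : T !=set0 by exists t.
rewrite /inf_nu !asboolT //=.
set iU := ereal_inf _; set iS := ereal_inf _; set iT := ereal_inf _.
(* The infimum over [S] is taken first, with the point of [T] fixed. *)
have iU_le r : T r -> (iU <= iS + r%:E)%E.
  move=> Tr; rewrite -leeBlDr //.
  apply: le_ereal_inf_tmp => _ [q Sq <-].
  rewrite leeBlDr // -EFinD; apply: ereal_inf_lbound.
  by exists (q + r) => //; exact: STU.
have iS_le : (iS <= s%:E)%E by apply: ereal_inf_lbound; exists s.
case: iS iS_le iU_le => [i| |] // _ iU_le.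
- rewrite -leeBlDl //; apply: le_ereal_inf_tmp => _ [r Tr <-].
  by rewrite leeBlDl //; exact: iU_le.
- exact: iU_le Tt.
Qed.

(** This is the domain of [phi M k]: outside [M + R k] the infimum runs over
    the empty set and takes the value nu. *)
Lemma minkowski_sum_lineE (R : realType) (V : lmodType R) (M : set V)
    (k y : V) :
  minkowski_sum M (line k) y <->
  [set t : R | [set t *: k + m | m in M] y] !=set0.
Proof.
split=> [[m Mm [_ [t _ <-] <-]]|[t [m Mm <-]]].
  by exists t; exists m; rewrite // addrC.
by exists m => //; exists (t *: k); [exists t | rewrite addrC].
Qed.

Theorem proposition3 (R : realType) (Y : topologicalLmodType R)
    (A : set Y) (k : Y)
    (A_closed : closed A) (A_proper : proper_subset A)
    (kA : (opp_set (recession_cone A) `\ 0) k) :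
  [/\ closed (recession_cone A),
      proper_subset (recession_cone A),
      (opp_set (recession_cone (recession_cone A)) `\ 0) k
    & forall y0 y1 : Y,
        minkowski_sum A (line k) y0 ->
        minkowski_sum (recession_cone A) (line k) y1 ->
        minkowski_sum A (line k) (y0 + y1) /\
        le_nu (phi A k (y0 + y1))
              (add_nu (phi A k y0) (phi (recession_cone A) k y1))].

Proof.
have shift (y0 y1 : Y) (s t : R) :
    [set s *: k + a | a in A] y0 ->
    [set t *: k + u | u in recession_cone A] y1 ->
    [set (s + t) *: k + a | a in A] (y0 + y1).
  move=> [a Aa <-] [u ru <-].
  by exists (a + u); [exact: recession_cone_add | rewrite scalerDl addrACA].
split.
- exact: closed_recession_cone.
- exact: recession_cone_proper.
- case: kA => -[u ru uk] k0; split=> //.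
  by exists u => //; exact: recession_cone_sub_idem.
- move=> y0 y1 /minkowski_sum_lineE S0 /minkowski_sum_lineE T0; split.
    case: S0 T0 => s Ss [t Tt]; apply/minkowski_sum_lineE.
    by exists (s + t); exact: shift.
  by apply: le_inf_nuD => // s t; exact: shift.
Qed.
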